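(* Let $R$ be a commutative ring with $1$ in which $2$ is invertible. Let $L$ and $L'$ be Lie superalgebras over $R$, let $f:L\to L'$ be a triple homomorphism, and let $M$ be the enveloping Lie superalgebra of $f(L)$. Assume that (1) $L$ is perfect (i.e. $[L,L]=L$); (2) $M$ is centerless (i.e. $\mathrm{Z}(M)=0$) and can be decomposed into a direct sum of indecomposable ideals. Then $f$ is either a homomorphism, or an anti-homomorphism, or a direct sum of a homomorphism and an anti-homomorphism.
   Context: A Lie superalgebra over a commutative ring $R$ with $1$ is a $\mathbf{Z}_2$-graded $R$-algebra $L=L_{\bar 0}\oplus L_{\bar 1}$ whose multiplication $[\,,\,]$ satisfies, for all homogeneous $x,y,z$: $[x,y]=-(-1)^{|x||y|}[y,x]$ and $[x,[y,z]]=[[x,y],z]+(-1)^{|x||y|}[y,[x,z]]$, where $|x|$ is the $\mathbf{Z}_2$-degree of $x$. Subalgebras and ideals are understood in the $\mathbf{Z}_2$-graded sense. The center is $\mathrm{Z}(L)=\{x\in L:[x,L]=0\}$. For a subset $S$ of a Lie superalgebra, the enveloping Lie superalgebra of $S$ is the Lie subalgebra generated by $S$. A Lie superalgebra is indecomposable if it cannot be written as a direct sum of two nontrivial (nonzero) ideals. An even $R$-linear map $f:L\to L'$ (even: degree-preserving) between Lie superalgebras is called: a homomorphism if $f([x,y])=[f(x),f(y)]$ for all $x,y\in L$; an anti-homomorphism if $f([x,y])=(-1)^{|x||y|}[f(y),f(x)]$ for all homogeneous $x,y\in L$; a triple homomorphism if $f([x,[y,z]])=[f(x),[f(y),f(z)]]$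 for all $x,y,z\in L$. A map $g:L\to L'$ is called a direct sum of maps $g_1$ and $g_2$ if $g=g_1+g_2$ and there exist ideals $I_1,I_2$ of the enveloping Lie superalgebra of $g(L)$ such that $I_1\cap I_2=0$, $g_1(L)\subseteq I_1$ and $g_2(L)\subseteq I_2$. *)

(* Defs.v *)
From HB Require Import structures.
From mathcomp Require Import all_boot all_order all_algebra.
From mathcomp Require Import boolp classical_sets.

Set Implicit Arguments.
Unset Strict Implicit.
Unset Printing Implicit Defensive.

Import GRing.Theory.
Local Open Scope classical_set_scope.
Local Open Scope ring_scope.

Definition is_submod (R : pzRingType) (V : lmodType R) (A : set V) : Prop :=
  A 0 /\ forall (a : R) (u v : V), A u -> A v -> A (a *: u + v).

(* Z_2 is represented by bool, false being the even degree: degrees add with *)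
(* (+) and multiply with &&.  Unlike some references, we do not assume       *)
(* [x, [x, x]] = 0 for odd x; the Jacobi identity only gives it times 3.     *)
HB.mixin Record Lmodule_isLieSuperalgebra (R : comPzRingType) L
    of GRing.Lmodule R L := {
  hompart : bool -> set L;
  bracket : L -> L -> L;
  hompart_submod : forall a : bool, is_submod (hompart a);
  hompart_sum : forall x : L, exists2 x0, hompart false x0 &
                  exists2 x1, hompart true x1 & x = x0 + x1;
  hompart_direct : hompart false `&` hompart true = [set 0];
  bracket_linearl : forall y : L, linear (bracket^~ y);
  bracket_linearr : forall x : L, linear (bracket x);
  bracket_hompart : forall (a b : bool) (x y : L),
    hompart a x -> hompart b y -> hompart (a (+) b) (bracket x y);
  bracket_skew : forall (a b : bool) (x y : L),
    hompart a x -> hompart b y ->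
    bracket x y = - ((-1) ^+ (a && b) *: bracket y x);
  bracket_jacobi : forall (a b c : bool) (x y z : L),
    hompart a x -> hompart b y -> hompart c z ->
    bracket x (bracket y z) =
      bracket (bracket x y) z + (-1) ^+ (a && b) *: bracket y (bracket x z)
}.

#[short(type="lieSuperalgType")]
HB.structure Definition LieSuperalgebra (R : comPzRingType) :=
  {L of Lmodule_isLieSuperalgebra R L & GRing.Lmodule R L}.

Section SubObjects.
Variables (R : comPzRingType) (L : lieSuperalgType R).
Implicit Types (A I J : set L).

Definition is_graded_submod A : Prop :=
  is_submod A /\
  A `<=` [set x0 + x1 | x0 in A `&` hompart false & x1 in A `&` hompart true].

Definition is_subalg A : Prop :=
  is_graded_submod A /\ forall x y, A x -> A y -> A (bracket x y).

(* A is meant to be a graded subalgebra, I an ideal of A seen as an algebra. *)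
Definition is_ideal A I : Prop :=
  [/\ is_graded_submod I, I `<=` A &
      forall x y, A x -> I y -> I (bracket x y) /\ I (bracket y x)].

Definition enveloping (S : set L) : set L := smallest is_subalg S.

Definition center A : set L :=
  [set x | A x /\ forall y, A y -> bracket x y = 0].

Definition centerless A : Prop := center A = [set 0].

Definition perfect : Prop :=
  smallest (@is_submod R L) [set bracket x y | x in [set: L] & y in [set: L]]
    = [set: L].

Definition indecomposable A : Prop :=
  ~ exists I J, [/\ is_ideal A I, is_ideal A J, I <> [set 0] & J <> [set 0]] /\
      (A = [set x + y | x in I & y in J] /\ I `&` J = [set 0]).

(* The index type T may be infinite. *)
Definition is_direct_sum (T : Type) A (N : T -> set L) : Prop :=
  A = smallest (@is_submod R L) (\bigcup_i N i) /\
  forall i, N i `&` smallest (@is_submod R L) (\bigcup_(j in [set~ i]) N j)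
              = [set 0].

Definition sum_of_indecomposable_ideals A : Prop :=
  exists (T : Type) (N : T -> set L),
    (forall i, is_ideal A (N i) /\ indecomposable (N i)) /\ is_direct_sum A N.

End SubObjects.

Arguments perfect {R} L.

Section Maps.
Variables (R : comPzRingType) (L L' : lieSuperalgType R).
Implicit Types f g : L -> L'.

Definition even_linear f : Prop :=
  linear f /\ forall (a : bool) (x : L), hompart a x -> hompart a (f x).

Definition is_hom f : Prop :=
  even_linear f /\ forall x y, f (bracket x y) = bracket (f x) (f y).

Definition is_antihom f : Prop :=
  even_linear f /\
  forall (a b : bool) (x y : L), hompart a x -> hompart b y ->
    f (bracket x y) = (-1) ^+ (a && b) *: bracket (f y) (f x).

Definition is_triple_hom f : Prop :=
  even_linear f /\
  forall x y z,
    f (bracket x (bracket y z)) = bracket (f x) (bracket (f y) (f z)).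

Definition map_direct_sum g g1 g2 : Prop :=
  (forall x, g x = g1 x + g2 x) /\
  exists I1 I2 : set L',
    [/\ is_ideal (enveloping (range g)) I1,
        is_ideal (enveloping (range g)) I2,
        I1 `&` I2 = [set 0],
        range g1 `<=` I1 & range g2 `<=` I2].

End Maps.

(* Main.v *)
Require Import Defs.
From mathcomp Require Import all_boot all_order all_algebra.
From mathcomp Require Import boolp classical_sets.

(** Why the theorem holds.  Write [M] for the enveloping superalgebra of
    [f(L)].  An element of [M] that commutes with [f(L)] is central in [M],
    hence zero ([centralizer_enveloping_eq0]); so an element [w] of [M] is
    determined by the map [bracket (f _) w].

    Since [L] is perfect and [f] preserves triple brackets, every [x] in [L]
    admits some [w] in [M] such that [bracket (f z) w = f (bracket z x)] for
    all [z]: for [x = bracket a b] take [w = bracket (f a) (f b)].  As [w] is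
    unique, this defines a map [d : L -> M], and uniqueness also shows that
    [d] is even, linear and a homomorphism ([companion_exists]).  The outcome
    is that [f] and [d] multiply like the two elements of a group of order
    two, with [d] as its unit:
      [bracket (f x) (f y) = d (bracket x y) = bracket (d x) (d y)],
      [bracket (f x) (d y) = f (bracket x y) = bracket (d x) (f y)].

    Thus [bracket] multiplies combinations [a f + b d] as the group algebra
    does ([comb_bracket]).  As [2] is invertible, this algebra has the
    orthogonal idempotents [(d + f) / 2] and [(d - f) / 2].  They give two
    homomorphisms with commuting images; the opposite of the second one is an
    anti-homomorphism by skew-symmetry, so that
    [f = (f + d) / 2 + (f - d) / 2] is the sum of a homomorphism and an
    anti-homomorphism.  The sum of the two commuting images is a subalgebra of
    [M] containing [f(L)], so it is [M]; hence both images are ideals of [M]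
    ([range_ideal]), and their intersection is central in [M], hence zero. *)

Set Implicit Arguments.
Unset Strict Implicit.
Unset Printing Implicit Defensive.

Import GRing.Theory.
Local Open Scope classical_set_scope.
Local Open Scope ring_scope.

(** * Linear maps and submodules *)

Section Linear.
Variables (R : pzRingType) (U V : lmodType R).
Implicit Types g h : U -> V.

Lemma linear_add g : linear g -> {morph g : x y / x + y}.
Proof. by move=> gl x y; have := gl 1 x y; rewrite !scale1r. Qed.

Lemma linear_zero g : linear g -> g 0 = 0.
Proof.
move=> gl; apply: (addrI (g 0)).
by rewrite -(linear_add gl) !addr0.
Qed.

Lemma linear_scale g : linear g -> forall a, {morph g : x / a *: x}.
Proof.
by move=> gl a x; have := gl a x 0; rewrite (linear_zero gl) !addr0.
Qed.

Lemma linear_opp g : linear g -> {morph g : x / - x}.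
Proof. by move=> gl x; rewrite -scaleN1r (linear_scale gl) scaleN1r. Qed.

End Linear.

Section Submodule.
Variables (R : pzRingType) (V : lmodType R) (A : set V).
Hypothesis A_submod : is_submod A.

Lemma submod_add x y : A x -> A y -> A (x + y).
Proof. by move=> Ax Ay; rewrite -[x]scale1r; apply: A_submod.2. Qed.

Lemma submod_scale a x : A x -> A (a *: x).
Proof.
by move=> Ax; rewrite -[_ *: _]addr0; apply: A_submod.2 => //; case: A_submod.
Qed.

Lemma submod_opp x : A x -> A (- x).
Proof. by move=> Ax; rewrite -scaleN1r; apply: submod_scale. Qed.

End Submodule.

Arguments bracket_skew {R s a b x y} _ _.
Arguments bracket_jacobi {R s a b c x y z} _ _ _.

(** * Homogeneous components and the enveloping subalgebra *)

Section Superalgebra.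
Variables (R : comPzRingType) (L : lieSuperalgType R).
Implicit Types (x y z w : L) (A S : set L).

Lemma bracketDr x y z : bracket x (y + z) = bracket x y + bracket x z.
Proof. exact: (linear_add (bracket_linearr x)). Qed.

Lemma bracketDl x y z : bracket (x + y) z = bracket x z + bracket y z.
Proof. exact: (linear_add (bracket_linearl z)). Qed.

Lemma bracketZr a x y : bracket x (a *: y) = a *: bracket x y.
Proof. exact: (linear_scale (bracket_linearr x)). Qed.

Lemma bracketZl a x y : bracket (a *: x) y = a *: bracket x y.
Proof. exact: (linear_scale (bracket_linearl y)). Qed.

Lemma bracket0r x : bracket x 0 = 0.
Proof. exact: (linear_zero (bracket_linearr x)). Qed.

Lemma bracket0l x : bracket 0 x = 0.
Proof. exact: (linear_zero (bracket_linearl x)). Qed.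

Lemma homogeneous_ind (P : L -> Prop) :
  (forall a x, hompart a x -> P x) ->
  (forall x y, P x -> P y -> P (x + y)) -> forall x, P x.
Proof.
move=> Phom Padd x; have [x0 h0 [x1 h1 ->]] := hompart_sum x.
by apply: Padd; [apply: Phom h0 | apply: Phom h1].
Qed.

Lemma hompart_add_eq0 a x y :
  hompart a x -> hompart (~~ a) y -> x + y = 0 -> x = 0 /\ y = 0.
Proof.
move=> hx hy xy0; have xNy : x = - y by apply/eqP; rewrite -addr_eq0 xy0.
have x0 : x = 0.
  have hx' : hompart (~~ a) x.
    by rewrite xNy; apply: submod_opp hy; apply: hompart_submod.
  suff : (hompart false `&` hompart true : set L) x by rewrite hompart_direct.
  by case: a hx hx' {hy} => /= hx hx'.
by split=> //; rewrite -xy0 x0 add0r.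
Qed.

Lemma hompart_decomp_uniq x0 x1 y0 y1 :
  hompart false x0 -> hompart false y0 -> hompart true x1 -> hompart true y1 ->
  x0 + x1 = y0 + y1 -> x0 = y0 /\ x1 = y1.
Proof.
move=> hx0 hy0 hx1 hy1 e.
have [] := @hompart_add_eq0 false (x0 - y0) (x1 - y1).
- apply: submod_add; [exact: hompart_submod | exact: hx0 |].
  by apply: submod_opp hy0; apply: hompart_submod.
- apply: submod_add; [exact: hompart_submod | exact: hx1 |].
  by apply: submod_opp hy1; apply: hompart_submod.
- by rewrite addrACA e -opprD subrr.
by move=> /eqP + /eqP; rewrite !subr_eq0 => /eqP -> /eqP ->.
Qed.

Lemma graded_components A x0 x1 : is_graded_submod A ->
  hompart false x0 -> hompart true x1 -> A (x0 + x1) -> A x0 /\ A x1.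
Proof.
move=> [_ Agr] h0 h1 /Agr [y0 [Ay0 hy0] [y1 [Ay1 hy1]] e].
by have [<- <-] := hompart_decomp_uniq hy0 h0 hy1 h1 e.
Qed.

Lemma enveloping_subalg S : is_subalg (enveloping S).
Proof.
split; last first.
  by move=> x y Sx Sy A [Aalg SA]; apply: Aalg.2; [apply: Sx | apply: Sy].
split.
  split=> [A [[[Asub _] _] _]|a u v Su Sv A AS]; first by case: Asub.
  by case: (AS) => [[[Asub _] _] _]; apply: Asub.2; [apply: Su | apply: Sv].
move=> x Sx; have [x0 h0 [x1 h1 xE]] := hompart_sum x.
have comps A : is_subalg A /\ S `<=` A -> A x0 /\ A x1.
  move=> AS; apply: graded_components => //; first by case: AS => [[]].
  by rewrite -xE; apply: Sx.
exists x0; first by split=> // A AS; case: (comps A AS).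
by exists x1 => //; split=> // A AS; case: (comps A AS).
Qed.

Lemma sub_enveloping S : S `<=` enveloping S.
Proof. by move=> x Sx A [_]; apply. Qed.

Lemma enveloping_min S A : is_subalg A -> S `<=` A -> enveloping S `<=` A.
Proof. by move=> Aalg SA x; apply. Qed.

(** For a homogeneous [w] the Jacobi identity says that [bracket w] is a
    superderivation; its kernel is therefore a graded subalgebra. *)
Lemma kernel_bracket_subalg a w :
  hompart a w -> is_subalg [set y | bracket w y = 0].
Proof.
move=> hw.
have comps y0 y1 : hompart false y0 -> hompart true y1 ->
    bracket w (y0 + y1) = 0 -> bracket w y0 = 0 /\ bracket w y1 = 0.
  rewrite bracketDr => h0 h1.
  apply: (@hompart_add_eq0 (a (+) false)); first exact: bracket_hompart.
  by rewrite -addbN; apply: bracket_hompart.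
split; first split.
- split=> [|c u v /= wu wv]; first exact: bracket0r.
  by rewrite bracketDr bracketZr wu wv scaler0 addr0.
- move=> y; have [y0 h0 [y1 h1 ->]] := hompart_sum y.
  by move=> /(comps _ _ h0 h1) [? ?]; exists y0 => //; exists y1.
move=> x y; have [x0 hx0 [x1 hx1 ->]] := hompart_sum x.
move=> /(comps _ _ hx0 hx1) [wx0 wx1] /= wy.
have kill b t : hompart b t -> bracket w t = 0 -> bracket w (bracket t y) = 0.
  move=> ht wt; move: y wy.
  have jac y : bracket w (bracket t y) =
      bracket (bracket w t) y + (-1) ^+ (a && b) *: bracket t (bracket w y).
    elim/homogeneous_ind: y => [c y hy|y z jy jz].
      exact: bracket_jacobi hy.
    by rewrite !bracketDr jy jz scalerDr addrACA.
  by move=> y wy; rewrite jac wt wy bracket0l bracket0r scaler0 addr0.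
by rewrite bracketDl bracketDr (kill _ _ hx0) ?(kill _ _ hx1) ?addr0.
Qed.

End Superalgebra.

(** * Images of even linear maps *)

Section Images.
Variables (R : comPzRingType) (L L' : lieSuperalgType R).
Implicit Types (f g h : L -> L') (M : set L').

Lemma range_graded g : even_linear g -> is_graded_submod (range g).
Proof.
move=> [gl gev]; split; first split.
- by exists 0 => //; apply: linear_zero gl.
- move=> a _ _ [x _ <-] [y _ <-]; exists (a *: x + y) => //; exact: gl.
move=> _ [x _ <-]; have [x0 h0 [x1 h1 ->]] := hompart_sum x.
exists (g x0); first by split; [exists x0 | apply: gev].
by exists (g x1); [split; [exists x1 | apply: gev] | rewrite (linear_add gl)].
Qed.

Lemma range_ideal M g h : even_linear g -> range g `<=` M ->
  (forall w, M w -> exists a b, w = g a + h b) ->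
  (forall x y, range g (bracket (g x) (g y))) ->
  (forall x y, bracket (h x) (g y) = 0) ->
  (forall x y, bracket (g x) (h y) = 0) ->
  is_ideal M (range g).
Proof.
move=> gev gM Msum gg hg gh; split=> // [|w v Mw]; first exact: range_graded.
move=> [c _ <-]; have [a [b ->]] := Msum w Mw.
by rewrite bracketDl bracketDr hg gh !addr0.
Qed.

Lemma sum_ranges_subalg g h : even_linear g -> even_linear h ->
  (forall x y, range g (bracket (g x) (g y))) ->
  (forall x y, range h (bracket (h x) (h y))) ->
  (forall x y, bracket (h x) (g y) = 0) ->
  (forall x y, bracket (g x) (h y) = 0) ->
  is_subalg [set w | exists a b, w = g a + h b].
Proof.
move=> [gl gev] [hl hev] gg hh hg gh; split; first split.
- split; first by exists 0, 0; rewrite (linear_zero gl) (linear_zero hl) addr0.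
  move=> c _ _ [a [b ->]] [a' [b' ->]]; exists (c *: a + a'), (c *: b + b').
  by rewrite gl hl scalerDr addrACA.
- move=> _ [a [b ->]]; have [a0 ha0 [a1 ha1 ->]] := hompart_sum a.
  have [b0 hb0 [b1 hb1 ->]] := hompart_sum b.
  have in_part c x y : hompart c x -> hompart c y -> hompart c (g x + h y).
    move=> hx hy; apply: submod_add; first exact: hompart_submod.
      exact: gev.
    exact: hev.
  exists (g a0 + h b0); first by split; [exists a0, b0 | exact: in_part].
  exists (g a1 + h b1); first by split; [exists a1, b1 | exact: in_part].
  by rewrite (linear_add gl) (linear_add hl) addrACA.
- move=> _ _ [a [b ->]] [a' [b' ->]].
  have [c _ gc] := gg a a'; have [e _ he] := hh b b'.
  by exists c, e; rewrite !(bracketDl, bracketDr) hg gh addr0 add0r gc he.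
Qed.

Lemma opp_hom_antihom h : even_linear h ->
  (forall x y, h (bracket x y) = - bracket (h x) (h y)) -> is_antihom h.
Proof.
move=> [hl hev] hb; split=> // a b x y hx hy.
by rewrite hb (bracket_skew (hev _ _ hx) (hev _ _ hy)) opprK.
Qed.

(** Both components of [w] also commute with [range f], because they send
    homogeneous elements of [range f] to different degrees; and the kernel of
    the bracket with a homogeneous element is a subalgebra. *)
Lemma centralizer_enveloping_eq0 f : even_linear f ->
  centerless (enveloping (range f)) ->
  forall w, enveloping (range f) w -> (forall x, bracket (f x) w = 0) -> w = 0.
Proof.
move=> [fl fev] fcent w; have [w0 h0 [w1 h1 ->]] := hompart_sum w.
move=> Mw fw; have [Mgr _] := enveloping_subalg (range f).
have [Mw0 Mw1] := graded_components Mgr h0 h1 Mw.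
have comps a x : hompart a x -> bracket (f x) w0 = 0 /\ bracket (f x) w1 = 0.
  move=> /fev hx; apply: (@hompart_add_eq0 _ _ (a (+) false)).
  - exact: bracket_hompart.
  - by rewrite -addbN; apply: bracket_hompart.
  - by rewrite -bracketDr fw.
have central a v : hompart a v -> enveloping (range f) v ->
    (forall b x, hompart b x -> bracket (f x) v = 0) -> v = 0.
  move=> hv Mv fv; suff : center (enveloping (range f)) v by rewrite fcent.
  split=> // y; apply: (enveloping_min (kernel_bracket_subalg hv)).
  move=> _ [x _ <-] /=; elim/homogeneous_ind: x => [b x hx|x x' vx vx'].
    by rewrite (bracket_skew hv (fev _ _ hx)) (fv _ _ hx) scaler0 oppr0.
  by rewrite (linear_add fl) bracketDr vx vx' addr0.
have -> : w0 = 0 by apply: (central false) => // b x /comps[].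
have -> : w1 = 0 by apply: (central true) => // b x /comps[].
exact: addr0.
Qed.

End Images.

(** * The companion homomorphism of a triple homomorphism *)

Section Companion.
Variables (R : comPzRingType) (L L' : lieSuperalgType R).

(** Multiplication table of the group of order two with unit [d] and
    involution [f]. *)
Definition companion (f d : L -> L') : Prop :=
  [/\ forall x y, bracket (f x) (f y) = d (bracket x y),
      forall x y, bracket (f x) (d y) = f (bracket x y),
      forall x y, bracket (d x) (f y) = f (bracket x y) &
      forall x y, bracket (d x) (d y) = d (bracket x y)].

Variable f : L -> L'.
Hypothesis f_triple : is_triple_hom f.
Hypothesis M_centerless : centerless (enveloping (range f)).
Local Notation M := (enveloping (range f)).

Lemma enveloping_range_inj v w : M v -> M w ->
  (forall z, bracket (f z) v = bracket (f z) w) -> v = w.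
Proof.
have [Msub _] := (enveloping_subalg (range f)).1.
move=> Mv Mw fvw; apply/eqP; rewrite -subr_eq0; apply/eqP.
apply: (centralizer_enveloping_eq0 f_triple.1 M_centerless) => [|x].
  by apply: (submod_add Msub) => //; apply: (submod_opp Msub).
by rewrite -scaleN1r bracketDr bracketZr fvw scaleN1r subrr.
Qed.

(** The witnesses [bracket (f a) (f b)] for brackets combine linearly, and
    brackets span a perfect [L]. *)
Lemma companion_witness : perfect L ->
  forall x, exists w, M w /\ forall z, bracket (f z) w = f (bracket z x).
Proof.
have [[fl fev] fb] := f_triple; move=> Lperf x.
have [[Msub _] Malg] := enveloping_subalg (range f).
have Mf y : M (f y) by apply: sub_enveloping; exists y.
have Lx : smallest (@is_submod R L)
    [set bracket a b | a in [set: L] & b in [set: L]] x.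
  by rewrite (Lperf : _ = _).
apply: (Lx [set t |
  exists w, M w /\ forall z, bracket (f z) w = f (bracket z t)]).
split; first split.
- exists 0; split=> [|z]; first by case: Msub.
  by rewrite !bracket0r (linear_zero fl).
- move=> a u v [wu [Mu fu]] [wv [Mv fv]]; exists (a *: wu + wv).
  split=> [|z]; first exact: Msub.2.
  by rewrite !bracketDr !bracketZr fl fu fv.
move=> _ [a _ [b _ <-]]; exists (bracket (f a) (f b)).
by split=> [|z]; [apply: Malg | rewrite fb].
Qed.

Lemma companion_exists : perfect L -> exists d : L -> L',
  [/\ even_linear d, forall x, M (d x) & companion f d].
Proof.
move=> Lperf; have [[fl fev] fb] := f_triple.
have [[Msub Mgr] Malg] := enveloping_subalg (range f).
have Mf y : M (f y) by apply: sub_enveloping; exists y.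
have [d dP] := choice (companion_witness Lperf).
have Md x : M (d x) := (dP x).1.
have fd z x : bracket (f z) (d x) = f (bracket z x) := (dP x).2 z.
have dl : linear d.
  move=> a x y; apply: enveloping_range_inj => // [|z].
    by apply: Msub.2.
  by rewrite bracketDr bracketZr !fd bracketDr bracketZr fl.
have ff x y : bracket (f x) (f y) = d (bracket x y).
  by apply: enveloping_range_inj => // [|z]; [apply: Malg | rewrite fd fb].
(* The component of [d x] of the wrong degree commutes with [range f]. *)
have dev a x : hompart a x -> hompart a (d x).
  move=> hx; have [v [w [hv hw dE Mw]]] : exists v w,
      [/\ hompart a v, hompart (~~ a) w, d x = v + w & M w].
    have [v0 [Mv0 h0] [v1 [Mv1 h1] dE]] := Mgr _ (Md x).
    case: (a) => /=; last by exists v0, v1; rewrite dE.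
    by exists v1, v0; rewrite addrC dE.
  suff w0 : w = 0 by rewrite dE w0 addr0.
  apply: (centralizer_enveloping_eq0 f_triple.1 M_centerless) => // z.
  elim/homogeneous_ind: z => [c z hz|z z' e e']; last first.
    by rewrite (linear_add fl) bracketDl e e' addr0.
  have hfz := fev _ _ hz.
  have hsub : hompart (c (+) a) (bracket (f z) v - f (bracket z x)).
    apply: submod_add; [exact: hompart_submod | exact: bracket_hompart |].
    apply: submod_opp; first exact: hompart_submod.
    by apply: fev; apply: bracket_hompart.
  have hw' : hompart (~~ (c (+) a)) (bracket (f z) w).
    by rewrite -addbN; apply: bracket_hompart.
  apply: (hompart_add_eq0 hsub hw' _).2.
  by rewrite addrAC -bracketDr -dE fd subrr.
have df x y : bracket (d x) (f y) = f (bracket x y).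
  elim/homogeneous_ind: x => [a x hx|x x' e e']; last first.
    by rewrite (linear_add dl) !bracketDl e e' (linear_add fl).
  elim/homogeneous_ind: y => [b y hy|y y' e e']; last first.
    by rewrite (linear_add fl) !bracketDr e e' (linear_add fl).
  rewrite (bracket_skew (dev _ _ hx) (fev _ _ hy)) fd.
  by rewrite (bracket_skew hx hy) (linear_opp fl) (linear_scale fl).
exists d; split=> //; split=> // x y.
apply: enveloping_range_inj => // [|z]; first by apply: Malg.
elim/homogeneous_ind: z => [c z hz|z z' e e']; last first.
  by rewrite (linear_add fl) !bracketDl e e'.
elim/homogeneous_ind: x => [a x hx|x x' e e']; last first.
  by rewrite (linear_add dl) !bracketDl (linear_add dl) !bracketDr e e'.
elim/homogeneous_ind: y => [b y hy|y y' e e']; last first.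
  by rewrite (linear_add dl) !bracketDr (linear_add dl) !bracketDr e e'.
rewrite (bracket_jacobi (fev _ _ hz) (dev _ _ hx) (dev _ _ hy)) !fd df.
by rewrite (bracket_jacobi hz hx hy) (linear_add fl) (linear_scale fl).
Qed.

End Companion.

(** * The two idempotents *)

Section Combinations.
Variables (R : comPzRingType) (L L' : lieSuperalgType R) (f d : L -> L').

Definition comb (a b : R) (x : L) : L' := a *: f x + b *: d x.

Lemma comb_even_linear a b :
  even_linear f -> even_linear d -> even_linear (comb a b).
Proof.
move=> [fl fev] [dl dev]; split=> [c x y|c x hx].
  rewrite /comb fl dl !scalerDr !scalerA ![_ * c]mulrC -!scalerA.
  by rewrite addrACA -scalerDr.
have psub := @hompart_submod R L' c.
by apply: submod_add => //; apply: submod_scale => //; [apply: fev | apply: dev].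
Qed.

Lemma comb_bracket a b a' b' x y : companion f d ->
  bracket (comb a b x) (comb a' b' y) =
    comb (a * b' + b * a') (a * a' + b * b') (bracket x y).
Proof.
move=> [ff fd df dd]; rewrite /comb !(bracketDl, bracketDr).
rewrite !(bracketZl, bracketZr) ff fd df dd !scalerA !scalerDl.
by rewrite [X in X + _ = _]addrC addrACA.
Qed.

End Combinations.

Theorem theorem1p2 (R : comPzRingType) (two_inv : exists u : R, 2%:R * u = 1)
    (L L' : lieSuperalgType R) (f : L -> L') (f_triple : is_triple_hom f)
    (L_perfect : perfect L)
    (M_centerless : centerless (enveloping (range f)))
    (M_decomp : sum_of_indecomposable_ideals (enveloping (range f))) :
  [\/ is_hom f, is_antihom f
    | exists g1 g2 : L -> L',
        [/\ is_hom g1, is_antihom g2 & map_direct_sum f g1 g2]].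
Proof.
have [u u2] := two_inv.
have [d [d_even Md fd]] := companion_exists f_triple M_centerless L_perfect.
have f_even := f_triple.1.
have [[Msub _] _] := enveloping_subalg (range f).
set M := enveloping (range f) in Md Msub M_centerless *.
have Mf x : M (f x) by apply: sub_enveloping; exists x.
have uu : u * u + u * u = u by rewrite -mulr2n -mulr_natl mulrA u2 mul1r.
(* [g] comes from an idempotent, [h] from the opposite of the other one. *)
pose g := comb f d u u; pose h := comb f d u (- u).
have g_even : even_linear g by apply: comb_even_linear.
have h_even : even_linear h by apply: comb_even_linear.
have gg x y : bracket (g x) (g y) = g (bracket x y).
  by rewrite comb_bracket // uu.
have hh x y : bracket (h x) (h y) = - h (bracket x y).
  rewrite comb_bracket // mulrNN mulrN mulNr -opprD uu.
  by rewrite /h /comb !scaleNr opprB addrC.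
have gh x y : bracket (g x) (h y) = 0.
  by rewrite comb_bracket // !mulrN addNr subrr /comb !scale0r addr0.
have hg x y : bracket (h x) (g y) = 0.
  by rewrite comb_bracket // !mulNr !subrr /comb !scale0r addr0.
have rgg x y : range g (bracket (g x) (g y)) by exists (bracket x y).
have rhh x y : range h (bracket (h x) (h y)).
  by exists (- bracket x y) => //; rewrite (linear_opp h_even.1) hh.
have f_sum x : f x = g x + h x.
  rewrite /g /h /comb scaleNr addrACA subrr addr0 -scalerDl -mulr2n -mulr_natl.
  by rewrite u2 scale1r.
have M_sum w : M w -> exists a b, w = g a + h b.
  apply: (enveloping_min (sum_ranges_subalg g_even h_even rgg rhh hg gh)).
  by move=> _ [x _ <-]; exists x, x.
have M_comb a b : range (comb f d a b) `<=` M.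
  by move=> _ [x _ <-]; apply: (submod_add Msub); apply: (submod_scale Msub).
apply: Or33; exists g, h; split.
- by split=> // x y; rewrite gg.
- by apply: opp_hom_antihom => // x y; rewrite hh opprK.
split=> //; exists (range g), (range h); split=> //.
- by apply: range_ideal M_sum _ _ _ => //; apply: M_comb.
- apply: (@range_ideal _ _ _ _ _ g) => //; first exact: M_comb.
  by move=> w /M_sum [a [b ->]]; exists b, a; rewrite addrC.
rewrite -M_centerless; apply/seteqP; split=> w; last first.
  rewrite M_centerless => ->; split; exists 0 => //.
    exact: linear_zero g_even.1.
  exact: linear_zero h_even.1.
move=> [[a _ ga] [b _ hb]]; split; first by rewrite -ga; apply: M_comb; exists a.
(* [w] commutes with [range g] as a value of [h], and conversely. *)
move=> y /M_sum [c [e ->]]; rewrite bracketDr -{1}hb hg add0r.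
by rewrite -ga gh.
Qed.
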